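(* Define constants $$C_0=\max(C_1/\delta,\delta),\quad b'=\max(b_0,2C_1+C_0),\quad \sigma=\bigl(1-e^{-I_M\delta^3}\bigr)/2,\quad D=D_{b'/a_0,\,a_0}.$$ For every $\eta'\in(0,1)$, for all positive $\varepsilon<(1-\eta')/(2D)$, and for every $f\in L^1(\mu)$ $$\mu\bigl(\{\mathcal{M}_2f>\alpha,\ f^{\sharp,b'}\le\varepsilon\alpha\}\bigr)\le\eta\,\mu\bigl(\{\mathcal{M}_2f>\eta'\alpha\}\bigr)\qquad\text{for all }\alpha>0,$$ where $$\eta=1-\sigma+\frac{2\varepsilon D}{\sigma(1-\eta')}.$$
   Context: Setting. $(M,\rho,\mu)$ is a metric measure space ($\mu$ a Borel measure), $M$ is unbounded, $\mu(M)>0$ and every ball has finite measure. $\mathcal{B}$ is the family of all balls of $M$; $c_B$, $r_B$ are the centre and radius of $B\in\mathcal{B}$, $\kappa B$ is the ball with centre $c_B$ and radius $\kappa r_B$; for $b>0$, $\mathcal{B}_b$ is the family of balls with $r_B\le b$. For $A\subset M$ and $\kappa>0$, $A_\kappa=\{x\in A:\rho(x,A^c)\le\kappa\}$. It is assumed that $M$ has the following three properties. Local doubling property (LDP): for every $b>0$ there is a constant $D_b$ such that $\mu(2B)\le D_b\,\mu(B)$ for all $B\in\mathcal{B}_b$. Isoperimetric property (I): there exist $\kappa_0,C>0$ such that for every bounded open set $A$, $\mu(A_\kappa)\ge C\kappa\,\mu(A)$ for all $\kappa\in(0,\kappa_0]$. For $t\in(0,\kappa_0]$ let $C_t$ be the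 supremum of the constants $C$ for which this inequality holds for all bounded open $A$ and all $\kappa\in(0,t]$; then $I_M=\sup\{C_t:t\in(0,\kappa_0]\}=\lim_{t\to0^+}C_t$. Approximate midpoint property (AMP): there exist $R_0\in[0,\infty)$ and $\beta\in(1/2,1)$ such that for every pair of points $x,y\in M$ with $\rho(x,y)>R_0$ there is a ball $B$ containing $x$ and $y$ with $r_B<\beta\,\rho(x,y)$. The constants $R_0,\beta$ are fixed. A constant $b_0>R_0/(1-\beta)$ is fixed. Doubling constants. For $\tau\ge2$ and $b>0$, $D_{\tau,b}$ is the smallest constant $C$ such that $\mu(B')\le C\mu(B)$ for each pair of balls $B\subset B'$ with $B\in\mathcal{B}_b$ and $r_{B'}\le\tau r_B$. Dyadic cubes. Fix a collection of open sets $\{Q_\alpha^k:k\in\mathbb{Z},\alpha\in I_k\}$, points $z_\alpha^k$, and constants $\delta\in(0,1)$, $a_0,C_1>0$ such that: $\bigcup_\alpha Q_\alpha^k$ has full measure in $M$ for each $k$; if $\ell\ge k$ then either $Q_\gamma^\ell\subset Q_\alpha^k$ or $Q_\gamma^\ell\cap Q_\alpha^k=\emptyset$; for each $(k,\alpha)$ and each $\ell<k$ there is a unique $\gamma$ with $Q_\alpha^k\subset Q_\gamma^\ell$; $\mathrm{diam}(Q_\alpha^k)\le C_1\delta^k$; $Q_\alpha^k\supset B(z_\alpha^k,a_0\delta^k)$ (such collections exist). The cubes $Q_\alpha^k$, $\alpha\in I_k$, are the dyadic cubes of resolution $k$. The null sets $M\setminus\bigcup_\alpha Q_\alpha^k$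 are regarded as deleted from the space. Maximal functions. For an integer $k$ and a locally integrable $f$, $\mathcal{M}_kf(x)=\sup_Q\frac1{\mu(Q)}\int_Q|f|\,d\mu$, the supremum over all dyadic cubes $Q$ of resolution $\ge k$ containing $x$. For $b>0$ the local sharp function is $f^{\sharp,b}(p)=\sup_B\frac1{\mu(B)}\int_B|f-f_B|\,d\mu$, the supremum over all $B\in\mathcal{B}_b$ containing $p$, where $f_B$ is the average of $f$ over $B$. *)

(* Defs.v *)
From HB Require Import structures.
From mathcomp Require Import all_boot all_order all_algebra.
From mathcomp Require Import all_classical all_reals all_analysis.

Set Implicit Arguments.
Unset Strict Implicit.
Unset Printing Implicit Defensive.

Import Order.TTheory GRing.Theory Num.Theory.

Local Open Scope classical_set_scope.
Local Open Scope ring_scope.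

HB.mixin Record isBorelMetric (d : measure_display) (R : realType) M
    & Measurable d M & Metric R M := {
  measurable_openE : (measurable : set (set M)) = <<s (open : set (set M)) >>
}.

#[short(type="borelMetricType")]
HB.structure Definition BorelMetric (d : measure_display) (R : realType) :=
  { M of Measurable d M & Metric R M & isBorelMetric d R M }.

(* In a metric space the set [ball c r] does not determine [c] and [r], so a
   ball [B] is always given by its centre [c] and its radius [r > 0]; balls are
   open, as in the library. *)

Section metric_notions.
Context {d : measure_display} {R : realType} {M : borelMetricType d R}.
Implicit Types (A : set M) (x : M).

Definition diam A : \bar R :=
  ereal_sup [set (mdist p.1 p.2)%:E | p in A `*` A].

Definition metric_bounded A : Prop := (diam A < +oo)%E.

(* Extended-real valued: the distance to the empty set is [+oo]. *)
Definition set_dist x A : \bar R := ereal_inf [set (mdist x y)%:E | y in A].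

Definition inner_boundary A (kappa : R) : set M :=
  [set x | A x /\ (set_dist x (~` A) <= kappa%:E)%E].

Definition approximate_midpoint (R0 beta : R) : Prop :=
  forall x y : M, R0 < mdist x y ->
    exists c : M, exists2 r : R, 0 < r < beta * mdist x y &
      ball c r x /\ ball c r y.

End metric_notions.

Section measure_notions.
Context {d : measure_display} {R : realType} {M : borelMetricType d R}.
Variable mu : {measure set M -> \bar R}.
Local Open Scope ereal_scope.

Definition locally_doubling : Prop :=
  forall b : R, (0 < b)%R -> exists D : R,
    forall (c : M) (r : R), (0 < r <= b)%R ->
      mu (ball c (2 * r)%R) <= D%:E * mu (ball c r).

Definition isoperimetric_ineq (t C : R) : Prop :=
  forall A : set M, open A -> metric_bounded A ->
    forall kappa : R, (0 < kappa <= t)%R ->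
      (C * kappa)%:E * mu A <= mu (inner_boundary A kappa).

Definition isoperimetric_const (t : R) : \bar R :=
  ereal_sup [set C%:E | C in isoperimetric_ineq t].

Definition isoperimetric_limit (kappa0 : R) : \bar R :=
  ereal_sup [set isoperimetric_const t | t in [set t : R | (0 < t <= kappa0)%R]].

Definition doubling_const (tau b : R) : R :=
  inf [set C : R | forall (c c' : M) (r r' : R),
    (0 < r <= b)%R -> (0 < r' <= tau * r)%R -> ball c r `<=` ball c' r' ->
    mu (ball c' r') <= C%:E * mu (ball c r)].

Definition mean (A : set M) (g : M -> R) : \bar R :=
  (mu A)^-1 * \int[mu]_(x in A) (g x)%:E.

Definition local_sharp (b : R) (f : M -> R) (p : M) : \bar R :=
  ereal_sup [set m | exists c : M, exists r : R,
    [/\ (0 < r <= b)%R, ball c r p &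
        m = mean (ball c r) (fun x => `|f x - fine (mean (ball c r) f)|%R)]].

(* Cubes of resolution [k] have size comparable to [delta ^ k], so they shrink
   as [k] grows.  Points lying in no cube of resolution [>= k] get the value
   [-oo], which removes the null sets left uncovered by the cubes from every
   superlevel set. *)
Definition dyadic_maximal (I : int -> Type) (Q : forall k : int, I k -> set M)
    (k : int) (f : M -> R) (x : M) : \bar R :=
  ereal_sup [set m | exists l : int, exists a : I l,
    [/\ (k <= l)%R, Q l a x & m = mean (Q l a) (fun y => `|f y|%R)]].

Record dyadic_cubes (I : int -> Type) (Q : forall k : int, I k -> set M)
    (z : forall k : int, I k -> M) (delta a0 C1 : R) : Prop := DyadicCubes {
  cube_open : forall k a, open (Q k a) ;
  cube_full : forall k, mu (~` \bigcup_a Q k a) = 0 ;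
  cube_nested : forall k l (a : I k) (g : I l), (k <= l)%R ->
    Q l g `<=` Q k a \/ Q l g `&` Q k a = set0 ;
  cube_ancestor : forall k l (a : I k), (l < k)%R ->
    exists! g : I l, Q k a `<=` Q l g ;
  cube_diam : forall k a, diam (Q k a) <= (C1 * delta ^ k)%:E ;
  cube_ball : forall k a, ball (z k a) (a0 * delta ^ k)%R `<=` Q k a
}.

End measure_notions.

(* Main.v *)
Require Import Defs.
From mathcomp Require Import all_boot all_order all_algebra.
From mathcomp Require Import all_classical all_reals all_analysis.
From mathcomp Require Import measurable_realfun ring lra zify.

(* The set [A = {M_2 f > eta' alpha}] is the disjoint union of its maximal
   "heavy" cubes, those of resolution [>= 2] on which [|f|] has mean
   [> eta' alpha].  Iterating the isoperimetric inequality on finer and finer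
   layers shows that a boundary layer of [A] of width less than [delta ^ 3]
   carries a proportion at least [sigma] of the mass of [A].  A maximal heavy
   cube of resolution [k] that meets this layer lies, together with a cube on
   which [|f|] has mean [<= eta' alpha], in one ball of radius [b' delta ^ k]:
   take the parent cube if [k > 2], a cube of resolution 2 met by a nearby point
   outside [A] if [k = 2].  A small sharp function at one point of the heavy
   cube then bounds the mean of [f] on the ball, and the dyadic weak type (1,1)
   inequality for [f - f_B] controls the part of [{M_2 f > alpha}] in the cube. *)

Set Implicit Arguments.
Unset Strict Implicit.
Unset Printing Implicit Defensive.

Import Order.TTheory GRing.Theory Num.Theory.

Local Open Scope classical_set_scope.
Local Open Scope ring_scope.

(** * Distance to a set, inner boundaries and erosion *)

Section borel_metric.
Context {d : measure_display} {R : realType} {M : borelMetricType d R}.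
Implicit Types (A : set M) (x y c : M) (r : R).

Lemma ballP c r x : ball c r x <-> mdist c x < r.
Proof. by rewrite ballEmdist. Qed.

Lemma open_ball c r : open (ball c r).
Proof.
rewrite openE => x /ballP cx; apply/nbhs_ballP.
exists (r - mdist c x) => /=; first by rewrite subr_gt0.
move=> y /ballP xy; apply/ballP.
by have := metric_triangle c x y; lra.
Qed.

Lemma borel_open A : open A -> measurable A.
Proof. by move=> oA; rewrite measurable_openE; exact: sub_sigma_algebra. Qed.

Lemma measurable_borel_ball c r : measurable (ball c r).
Proof. exact/borel_open/open_ball. Qed.

(** The infimum need not be attained, hence the slack [e]; for empty [A] both sides fail. *)
Lemma set_dist_leP x A (k : R) : (set_dist x A <= k%:E)%E <->
  forall e, 0 < e -> exists2 y, A y & mdist x y < k + e.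
Proof.
split=> [xA e e0|xA].
  have : (set_dist x A < (k + e)%:E)%E by rewrite (le_lt_trans xA)// lte_fin ltrDl.
  by move=> /ereal_inf_lt[_ [y Ay <-]]; rewrite lte_fin; exists y.
apply/lee_addgt0Pr => e /xA[y Ay xy].
by apply: ge_ereal_inf; exists (mdist x y)%:E; [exists y|rewrite -EFinD lee_fin ltW].
Qed.

Lemma set_dist_mem x A : A x -> (set_dist x A <= 0)%E.
Proof. by move=> Ax; apply/set_dist_leP => e e0; exists x; rewrite ?mdistxx ?add0r. Qed.

Lemma metric_bounded_ball A c r : A `<=` ball c r -> metric_bounded A.
Proof.
move=> Ac; rewrite /metric_bounded (@le_lt_trans _ _ (r + r)%:E) ?ltry//.
apply: ge_ereal_sup => _ [[x y] [/= /Ac/ballP cx /Ac/ballP cy] <-].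
rewrite lee_fin (le_trans (metric_triangle x c y))// (metric_sym x c).
by rewrite lerD// ltW.
Qed.

Definition eroded A (k : R) := A `\` inner_boundary A k.

(** Surviving points are at distance strictly more than [k] from the complement. Half of the margin
    [e] persists under a small move of the point, so erosion keeps sets open. *)
Lemma erodedP A k x :
  eroded A k x <-> A x /\ exists2 e, 0 < e & forall y, ~ A y -> k + e <= mdist x y.
Proof.
split=> [[Ax nAx]|[Ax [e e0 ke]]].
  split=> //; apply: contrapT => ne; apply: nAx; split => //; apply/set_dist_leP => e e0.
  apply: contrapT => nxy; apply: ne; exists e => // y nAy.
  by rewrite leNgt; apply/negP => xy; apply: nxy; exists y.
split=> //; case=> _ /set_dist_leP/(_ _ e0)[y /ke].
by move=> /le_lt_trans/[apply]; rewrite ltxx.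
Qed.

Lemma open_eroded A k : open A -> open (eroded A k).
Proof.
rewrite !openE => oA x /erodedP[Ax [e e0 ke]].
have e2 : 0 < e / 2 by rewrite divr_gt0.
near=> y; apply/erodedP; split; first by near: y; exact: oA.
exists (e / 2) => // w /ke kw; have := metric_triangle x y w.
suff : mdist x y < e / 2 by lra.
by apply/ballP; near: y; exact: nbhsx_ballx.
Unshelve. all: by end_near. Qed.

Lemma inner_boundaryE A k : inner_boundary A k = A `\` eroded A k.
Proof.
by rewrite /eroded setDD; apply/seteqP; split=> x [] //.
Qed.

Lemma measurable_inner_boundary A k : open A -> measurable (inner_boundary A k).
Proof.
move=> oA; rewrite inner_boundaryE.
by apply: measurableD; apply: borel_open => //; exact: open_eroded.
Qed.

(** Each erosion loses only points at distance at most [k] from the complement of the previous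
    stage; by the triangle inequality these distances add up. *)
Lemma iter_eroded_inner_boundary A k n : 0 <= k ->
  A `\` iter n (eroded ^~ k) A `<=` inner_boundary A (k *+ n).
Proof.
move=> k0 x [Ax nx]; split => //.
elim: n x nx {Ax} => [|n IH] x /=; first by rewrite mulr0n; exact: set_dist_mem.
set An := iter n _ A => nx; apply/set_dist_leP => e e0.
have [Anx|/IH/set_dist_leP/(_ _ e0)[y nAy xy]] := pselect (An x); last first.
  by exists y => //; rewrite mulrS; lra.
have [_ /set_dist_leP xAn] : inner_boundary An k x.
  by apply: contrapT => nb; apply: nx; split.
have e2 : 0 < e / 2 by rewrite divr_gt0.
have [y /IH/set_dist_leP/(_ _ e2)[w nAw yw] xy] := xAn _ e2.
exists w => //; rewrite mulrS; have := metric_triangle x y w; lra.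
Qed.

Lemma open_iter_eroded A k n : open A -> open (iter n (eroded ^~ k) A).
Proof. by move=> oA; elim: n => //= n; exact: open_eroded. Qed.

Lemma iter_eroded_sub A k n : iter n (eroded ^~ k) A `<=` A.
Proof. by elim: n => //= n IH x [/IH]. Qed.

End borel_metric.

(** * Exponential decay of mass under erosion *)

Section isoperimetry.
Context {d : measure_display} {R : realType} {M : borelMetricType d R}.
Variable mu : {measure set M -> \bar R}.
Implicit Types (A : set M) (t k C : R).

Lemma bigcup_setI_ball (c : M) A : \bigcup_n (A `&` ball c n%:R) = A.
Proof.
rewrite -setI_bigcupr setIidl// => x _.
by exists (Num.bound (mdist c x)) => //; apply/ballP/archi_boundP/mdist_ge0.
Qed.

Lemma cvg_measure_setI_ball (c : M) A : measurable A ->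
  (mu (A `&` ball c n%:R) @[n --> \oo] --> mu A)%E.
Proof.
move=> mA; rewrite -[X in _ --> mu X](bigcup_setI_ball c).
have mAn n : measurable (A `&` ball c n%:R) by apply/measurableI/measurable_borel_ball.
apply: nondecreasing_cvg_mu => //; first exact: bigcup_measurable.
move=> n m nm; apply/subsetPset => x [Ax /ballP cx]; split => //; apply/ballP.
by rewrite (lt_le_trans cx)// ler_nat.
Qed.

(* [A] is cut by balls: the inner boundary of [A `&` ball o r] is that of [A] up
   to a part of [A] close to the complement of the ball, of vanishing mass. *)
Lemma isoperimetric_fin t C : isoperimetric_ineq mu t C -> 0 <= C ->
  forall A, open A -> (mu A < +oo)%E -> forall k, 0 < k <= t ->
  ((C * k)%:E * mu A <= mu (inner_boundary A k))%E.
Proof.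
move=> iso C0 A oA Aoo k /andP[k0 kt].
have [->|/set0P[] o _] := eqVneq A set0.
  by rewrite measure0 mule0 measure_ge0.
have mA := borel_open oA.
have mAk := measurable_inner_boundary k oA.
have Afin : mu A \is a fin_num by rewrite ge0_fin_numE.
(* Adding [mu A] on the right absorbs the error, the mass of [A] outside [An]; the right side is
   then free of [n] and the limit can be taken on the left. *)
have key n : ((C * k + 1)%:E * mu (A `&` ball o n%:R) <= mu (inner_boundary A k) + mu A)%E.
  set An := A `&` _; have mAn : measurable An by apply/measurableI/measurable_borel_ball.
  (* The outer ball exceeds the inner one by more than [k + 1], so a point of the inner ball close
     to the complement of [B] is close to the complement of [A], not of the ball. *)
  pose m := Num.bound (k + 1).
  have km : k + 1 < m%:R by apply: archi_boundP; lra.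
  pose B := A `&` ball o (n + m)%:R.
  have oB : open B by apply/openI/open_ball.
  have bB : metric_bounded B by apply: (@metric_bounded_ball _ _ _ _ o (n + m)%:R) => x [].
  have kt' : 0 < k <= t by rewrite k0 kt.
  have := iso _ oB bB _ kt'.
  have AnB : (mu An <= mu B)%E.
    apply: le_measure; rewrite ?inE//; first exact: borel_open.
    move=> x [Ax /ballP ox]; split=> //; apply/ballP.
    by rewrite (lt_le_trans ox)// ler_nat leq_addr.
  have ABsub : inner_boundary B k `<=` inner_boundary A k `|` (A `\` An).
    move=> x [[Ax _] /set_dist_leP xB].
    have [xn|xn] := ltP (mdist o x) n%:R; last first.
      by right; split=> // -[_ /ballP]; rewrite ltNge xn.
    left; split => //; apply/set_dist_leP => e e0.
    have e1 : 0 < Num.min e 1 by rewrite lt_min e0 ltr01.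
    have [y nBy xy] := xB _ e1.
    exists y; last by rewrite (lt_le_trans xy)// lerD2l ge_min lexx.
    move=> Ay; apply: nBy; split=> //; apply/ballP.
    have := metric_triangle o x y; rewrite natrD.
    have : Num.min e 1 <= 1 by rewrite ge_min lexx orbT.
    by move: km xy xn; lra.
  have ABmu : (mu (inner_boundary B k) <= mu (inner_boundary A k) + mu (A `\` An))%E.
    apply: (@le_trans _ _ (mu (inner_boundary A k `|` (A `\` An)))).
      apply: le_measure; rewrite ?inE//; first exact: measurable_inner_boundary.
      by apply: measurableU => //; exact: measurableD.
    by apply: measureU2 => //; exact: measurableD.
  move=> isoB.
  have Anfin : mu An \is a fin_num.
    rewrite ge0_fin_numE// (le_lt_trans _ Aoo)// le_measure ?inE//; exact: subIsetl.
  have -> : (mu A = mu An + mu (A `\` An))%E.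
    by rewrite (measureDI mu mA mAn) addeC; congr (_ + mu _)%E; rewrite setIA setIid.
  rewrite EFinD muleDl ?fin_num_adde_defl// mul1e (addeC (mu An)) addeA leeD2r//.
  rewrite (le_trans _ (le_trans isoB ABmu))// lee_wpmul2l// lee_fin mulr_ge0// ltW//.
have : ((C * k + 1)%:E * mu A <= mu (inner_boundary A k) + mu A)%E.
  have Acvg : ((C * k + 1)%:E * mu (A `&` ball o n%:R) @[n --> \oo] -->
      (C * k + 1)%:E * mu A)%E.
    by apply: cvgeZl => //; exact: cvg_measure_setI_ball.
  apply: (cvge_to_le Acvg).
  exact: nearW.
by rewrite EFinD muleDl ?fin_num_adde_defl// mul1e leeD2rE.
Qed.

(** The width [s] is cut into [n] steps of width [k <= t]; each erosion by [k] leaves at most the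
    fraction [1 - C * k <= expR (- (C * k))] of the mass. *)
Lemma isoperimetric_exp t C s A : 0 < t -> 0 <= C -> isoperimetric_ineq mu t C ->
  0 < s -> open A -> (mu A < +oo)%E ->
  (mu (A `\` inner_boundary A s) <= (expR (- (C * s)))%:E * mu A)%E.
Proof.
move=> t0 C0 iso s0 oA Aoo.
pose n := Num.bound (s / t).
have st : s / t < n%:R by apply: archi_boundP; rewrite divr_ge0// ltW.
have n0 : 0 < n%:R :> R by rewrite (le_lt_trans _ st)// divr_ge0// ltW.
pose k := s / n%:R.
have k0 : 0 < k by rewrite divr_gt0.
have kt : 0 < k <= t.
  by rewrite k0/= ler_pdivrMr// mulrC -ler_pdivrMr// ltW.
have mA := borel_open oA.
have iter_le m : (mu (iter m (eroded ^~ k) A) <= (expR (- (C * k) *+ m))%:E * mu A)%E.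
  elim: m => [|m IH]; first by rewrite mulr0n expR0 mul1e.
  have oAm := open_iter_eroded k m oA.
  rewrite iterS; set Am := iter m _ A in IH oAm *.
  have mAm := borel_open oAm.
  have Amoo : (mu Am < +oo)%E.
    rewrite (le_lt_trans _ Aoo)// le_measure ?inE//; exact: iter_eroded_sub.
  have mb := measurable_inner_boundary k oAm.
  rewrite {1}/eroded measureD//.
  have -> : Am `&` inner_boundary Am k = inner_boundary Am k.
    by rewrite setIidr// => x [].
  have isoAm := isoperimetric_fin iso C0 oAm Amoo kt.
  have Amfin : mu Am \is a fin_num by rewrite ge0_fin_numE.
  apply: (@le_trans _ _ ((expR (- (C * k)))%:E * mu Am)%E).
    rewrite (@le_trans _ _ (mu Am - (C * k)%:E * mu Am)%E)//; first by rewrite leeB.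
    rewrite -[X in (X - _)%E]mul1e -muleBl ?fin_num_adde_defr//.
    rewrite lee_wpmul2r// -EFinB lee_fin.
    exact: expR_ge1Dx.
  rewrite mulrS expRD EFinM -muleA lee_wpmul2l// lee_fin expR_ge0//.
have := iter_le n; rewrite -[_ *+ n]mulr_natr.
have -> : - (C * k) * n%:R = - (C * s).
  by rewrite /k mulNr -mulrA divfK// gt_eqF.
apply: le_trans.
apply: le_measure; rewrite ?inE.
- by apply: measurableD => //; exact: measurable_inner_boundary.
- exact/borel_open/open_iter_eroded.
(* A point of [A] outside the layer of width [s = k * n] survives all [n] erosions. *)
move=> x [Ax nx]; apply: contrapT => nAn; apply: nx.
have := @iter_eroded_inner_boundary _ _ _ A k n (ltW k0) x (conj Ax nAn).
by rewrite -mulr_natr /k divfK// gt_eqF.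
Qed.

End isoperimetry.

(* The factors [3 / 4] and [1 / 2] leave room for working with a constant [C]
   below the (possibly unattained or infinite) limit and with a layer strictly
   thinner than [u]. *)
Lemma isoperimetric_limit_decay (d : measure_display) (R : realType) (M : borelMetricType d R)
    (mu : {measure set M -> \bar R}) (kappa0 C0 u : R) :
  0 < kappa0 -> 0 < C0 -> isoperimetric_ineq mu kappa0 C0 -> 0 < u ->
  let q := fine (expeR (- (isoperimetric_limit mu kappa0 * u%:E))) in
  0 <= q < 1 /\ exists t C : R, [/\ 0 < t, 0 <= C, isoperimetric_ineq mu t C &
    expR (- (C * (3 / 4 * u))) <= (1 + q) / 2].
Proof.
move=> kappa0_gt0 C00 iso0 u0.
set L := isoperimetric_limit mu kappa0 => q.
have L0 : (0 < L)%E.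
  apply: (@lt_le_trans _ _ C0%:E); first by rewrite lte_fin.
  apply: (@le_trans _ _ (isoperimetric_const mu kappa0)).
    by apply: ereal_sup_ubound; exists C0.
  by apply: ereal_sup_ubound; exists kappa0 => //=; rewrite kappa0_gt0 lexx.
have below (c : R) : (c%:E < L)%E ->
    exists t C : R, [/\ 0 < t, c < C & isoperimetric_ineq mu t C].
  move=> /ereal_sup_gt[_ [t /andP[t0 _] <-]] /ereal_sup_gt[_ [C isoC <-]] cC.
  by exists t, C; split.
case: L @q L0 below => [l| |]//; last first.
  move=> q _ below; have q0 : q = 0 by rewrite /q gt0_mulye// lte_fin.
  split; first by rewrite q0 lexx ltr01.
  (* With an infinite limit [q] is 0, and [C * u > 2] suffices since the exponential of
     [3 / 4 * (C * u)] is then at least [1 + 3 / 2]. *)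
  have [|t [C [t0 cC isoC]]] := below (2 / u); first exact: ltry.
  have C1 : 2 < C * u by rewrite -ltr_pdivrMr.
  exists t, C; split=> //.
    by apply: ltW; apply: lt_trans cC; rewrite divr_gt0.
  rewrite q0 addr0 expRN mul1r lef_pV2 ?posrE ?expR_gt0//.
  by apply: le_trans (expR_ge1Dx _); lra.
rewrite lte_fin => q l0 below.
have qE : q = expR (- (l * u / 2)) ^+ 2.
  by rewrite /q -EFinM -EFinN/= -expRM_natl; congr expR; field.
have q1 : q < 1 by rewrite /q -EFinM -EFinN/= expR_lt1 oppr_lt0 mulr_gt0.
split; first by rewrite q1 andbT qE sqr_ge0.
(* The factor [2 / 3] against [3 / 4] leaves the exponent [- (l * u / 2)], whose exponential is the
   square root of [q]; AM-GM bounds it by [(1 + q) / 2]. *)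
have [|t [C [t0 cC isoC]]] := below (2 / 3 * l); first by rewrite lte_fin; lra.
exists t, C; split=> //; first by apply: ltW; apply: lt_trans cC; lra.
apply: (@le_trans _ _ (expR (- (l * u / 2)))).
  rewrite ler_expR lerN2; have := ler_pM2r u0 (2 / 3 * l) C; rewrite (ltW cC); lra.
rewrite qE; have := sqr_ge0 (expR (- (l * u / 2)) - 1); lra.
Qed.

(** * Countability of disjoint families of sets of positive mass *)

Section disjoint_families.
Context {d : measure_display} {R : realType} {T : measurableType d}.
Variable mu : {measure set T -> \bar R}.
Implicit Types (F : set (set T)).

(** For each [n] only finitely many members have mass above [1 / (n + 1)] inside [E]: infinitely
    many disjoint ones would exceed the finite [mu E]. *)
Lemma countable_disjoint_family_fin F (E : set T) :
  trivIset F id -> (forall A, F A -> measurable A) -> measurable E -> (mu E < +oo)%E ->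
  countable [set A | F A /\ (0 < mu (A `&` E))%E].
Proof.
move=> tF mF mE Eoo.
have fin A : F A -> mu (A `&` E) \is a fin_num.
  move=> /mF mA; rewrite ge0_fin_numE// (le_lt_trans _ Eoo)// le_measure ?inE//.
  exact: measurableI.
rewrite [X in countable X](_ : _ =
    \bigcup_n [set A | F A /\ ((n.+1%:R^-1 : R)%:E < mu (A `&` E))%E]); last first.
  apply/seteqP; split=> [A/= [FA]|A [k _] /= [FA kA]]; last first.
    by split=> //; apply: lt_trans kA; rewrite lte_fin invr_gt0.
  rewrite -(fineK (fin _ FA)) lte_fin => /ltr_add_invr[k]; rewrite add0r => kA.
  by exists k => //; split => //; rewrite -(fineK (fin _ FA)) lte_fin.
apply: bigcup_countable => // n _; apply: finite_set_countable.
apply: contrapT => /infiniteP/pcard_leP/injfunPex[/= q q_fun q_inj].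
have mq k : measurable (q k `&` E).
  by apply: measurableI => //; apply: mF; have [] := q_fun k I.
have tq : trivIset setT (fun k => q k `&` E).
  apply/trivIsetP => i j _ _ ij; apply/seteqP; split=> // x [[qix _] [qjx _]].
  have [[Fi _] [Fj _]] := (q_fun i I, q_fun j I).
  have qij : q i = q j by apply: tF => //; exists x.
  by move/eqP: ij; apply; apply: q_inj qij; rewrite inE.
have qE : (mu (\bigcup_k (q k `&` E)) <= mu E)%E.
  apply: le_measure; rewrite ?inE//; first exact: bigcup_measurable.
  by move=> x [k _ []].
have key N : (N%:R / n.+1%:R <= fine (mu E))%R.
  rewrite -lee_fin fineK ?ge0_fin_numE// (le_trans _ qE)//.
  rewrite measure_bigcup//.
  rewrite (le_trans _ (nneseries_lim_ge N _))//.
  rewrite big_mkord.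
  rewrite (@le_trans _ _ (\sum_(i < N) (n.+1%:R^-1)%:E)%E)//.
    by rewrite sumEFin sumr_const card_ord mulr_natl.
  rewrite [leRHS]big_mkcond/=; apply: lee_sum => i _; rewrite in_setT.
  by have [_ /ltW] := q_fun i I.
have := key (Num.bound (n.+1%:R * fine (mu E))); rewrite ler_pdivrMr// leNgt mulrC.
by rewrite archi_boundP// mulr_ge0// fine_ge0.
Qed.

(** A set of positive mass meets some piece of a sigma-finite cover in positive mass, which reduces
    to the finite case. *)
Lemma countable_disjoint_family F : sigma_finite setT mu -> trivIset F id ->
  (forall A, F A -> measurable A) -> (forall A, F A -> 0 < mu A)%E -> countable F.
Proof.
move=> [E coverE finE] tF mF F0.
rewrite [X in countable X](_ : _ =
    \bigcup_n [set A | F A /\ (0 < mu (A `&` E n))%E]); last first.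
  apply/seteqP; split=> [A FA|A [n _ []]//].
  apply: contrapT => nA; have := F0 _ FA; rewrite ltNge => /negP; apply.
  have -> : A = \bigcup_n (A `&` E n) by rewrite -setI_bigcupr -coverE setIT.
  have mAE n : measurable (A `&` E n).
    by apply: measurableI; [exact: mF|case: (finE n)].
  have := @measure_sigma_subadditive _ _ _ mu (\bigcup_n (A `&` E n)) (fun n => A `&` E n) mAE.
  move=> /(_ (bigcupT_measurable _ mAE) (@subset_refl _ _)) /le_trans; apply.
  rewrite eseries0// => n _ _; apply/eqP; rewrite eq_le measure_ge0 andbT leNgt.
  by apply/negP => An; apply: nA; exists n.
apply: bigcup_countable => // n _; have [mE Eoo] := finE n.
exact: countable_disjoint_family_fin.
Qed.

(** Puts a family in the form required by countable additivity over sequences; a code that no member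
    has yields the empty set. *)
Lemma countable_disjoint_seq F : countable F -> trivIset F id ->
  exists G : nat -> set T, [/\ trivIset setT G, \bigcup_n G n = \bigcup_(A in F) A &
    forall n, G n = set0 \/ F (G n)].
Proof.
move=> /countable_injP[code codeI] tF.
pose G n := \bigcup_(A in [set A | F A /\ code A = n]) A.
have GE A : F A -> G (code A) = A.
  move=> FA; apply/seteqP; split=> [x [B [FB BA] Bx]|x Ax]; last by exists A.
  by rewrite -(codeI B A)// inE.
exists G; split.
- apply/trivIsetP => i j _ _ ij; apply/seteqP; split=> // x [[A [FA Ai] Ax] [B [FB Bj] Bx]].
  by move/eqP: ij; apply; rewrite -Ai -Bj (tF A B)//; exists x.
- apply/seteqP; split=> [x [n _ [A [FA _] Ax]]|x [A FA Ax]]; first by exists A.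
  by exists (code A) => //; exists A.
move=> n; have [[A [FA An]]|nA] := pselect (exists A, F A /\ code A = n).
  by right; rewrite -An GE.
by left; apply/seteqP; split=> // x [A [FA An]]; case: nA; exists A.
Qed.

End disjoint_families.

(** * Consequences of local doubling *)

Section doubling.
Context {d : measure_display} {R : realType} {M : borelMetricType d R}.
Variable mu : {measure set M -> \bar R}.
Hypothesis mu_gt0 : (0 < mu [set: M])%E.
Hypothesis mu_ball_fin : forall (c : M) (r : R), (mu (ball c r) < +oo)%E.
Hypothesis LDP : locally_doubling mu.

Lemma doubling_pow2 (b : R) n : 0 < b -> exists2 K : R, 0 <= K &
  forall (c : M) (r : R), 0 < r <= b -> (mu (ball c (2 ^+ n * r)) <= K%:E * mu (ball c r))%E.
Proof.
move=> b0; elim: n => [|n [K K0 IH]].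
  by exists 1 => // c r _; rewrite expr0 !mul1r mul1e.
have [|D LD] := LDP (b := 2 ^+ n * b); first by rewrite mulr_gt0// exprn_gt0.
exists (Num.max D 0 * K); first by rewrite mulr_ge0// le_max lexx orbT.
move=> c r /andP[r0 rb]; rewrite exprS -mulrA.
apply: le_trans (LD _ _ _) _; first by rewrite mulr_gt0 ?exprn_gt0//= ler_pM2l ?exprn_gt0.
rewrite (@le_trans _ _ ((Num.max D 0)%:E * mu (ball c (2 ^+ n * r)))%E)//.
  by rewrite lee_wpmul2r// lee_fin le_max lexx.
rewrite EFinM -muleA lee_wpmul2l//; first by rewrite lee_fin le_max lexx orbT.
by rewrite IH// r0 rb.
Qed.

(** Doubling spreads a null ball to all its dilates, which exhaust [M], against [mu_gt0]. *)
Lemma mu_ball_gt0 (c : M) (r : R) : 0 < r -> (0 < mu (ball c r))%E.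
Proof.
move=> r0; rewrite lt_neqAle measure_ge0 andbT eq_sym; apply/eqP => cr0.
suff : (mu [set: M] <= 0)%E by rewrite leNgt mu_gt0.
apply: (cvge_to_le (cvg_measure_setI_ball c (mu := mu) measurableT)); apply: nearW => n.
rewrite setTI; pose m := Num.bound (n%:R / r).
have [K _ /(_ c r)] := doubling_pow2 m r0.
rewrite r0 lexx cr0 mule0 => /(_ isT); apply: le_trans.
apply: le_measure; rewrite ?inE; try exact: measurable_borel_ball.
move=> x /ballP cx; apply/ballP; apply: (lt_le_trans cx); rewrite -ler_pdivrMr//.
apply: ltW; apply: lt_trans (archi_boundP _) _; first by rewrite divr_ge0// ltW.
by rewrite -natrX ltr_nat ltn_expl.
Qed.

(** The infimum is itself admissible, because one may divide by the positive finite mass of a ball.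
    That some constant exists must be checked, as [inf] of an empty set is 0. *)
Lemma doubling_constP (tau b : R) (c c' : M) (r r' : R) : 0 < b ->
  0 < r <= b -> 0 < r' <= tau * r -> ball c r `<=` ball c' r' ->
  (mu (ball c' r') <= (doubling_const mu tau b)%:E * mu (ball c r))%E.
Proof.
move=> b0 rb r't cc'.
have cr0 : (0 < mu (ball c r))%E by apply: mu_ball_gt0; case/andP: rb.
have crfin : mu (ball c r) \is a fin_num by rewrite ge0_fin_numE.
have c'fin : mu (ball c' r') \is a fin_num by rewrite ge0_fin_numE.
have fcr0 : 0 < fine (mu (ball c r)) by rewrite fine_gt0// cr0 mu_ball_fin.
rewrite -(fineK crfin) -(fineK c'fin) -EFinM lee_fin -ler_pdivrMr//.
apply: lb_le_inf; last first.
  move=> C /= /(_ c c' r r' rb r't cc').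
  by rewrite -(fineK crfin) -(fineK c'fin) -EFinM lee_fin -ler_pdivrMr.
(* The larger ball contains [c], so it lies in [ball c (2 * tau * r)], and [2 ^+ m] exceeds
   [2 * tau]. *)
pose m := Num.bound (2 * tau).
have [K K0 HK] := doubling_pow2 m b0.
exists K => /= {}c {}c' {}r {}r' {}rb {}r't {}cc' {cr0 crfin c'fin fcr0}.
apply: le_trans (HK _ _ rb); apply: le_measure; rewrite ?inE; try exact: measurable_borel_ball.
move/andP: rb => [r0 rb]; move/andP: r't => [r'0 r't].
have /cc'/ballP c'c : ball c r c by apply/ballP; rewrite mdistxx.
move=> x /ballP c'x; apply/ballP.
have tau0 : 0 <= tau by rewrite -(pmulr_lge0 _ r0) (le_trans _ r't)// ltW.
have : 2 * tau * r <= 2 ^+ m * r.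
  rewrite ler_pM2r//; apply: ltW; apply: lt_trans (archi_boundP _) _.
    by rewrite mulr_ge0.
  by rewrite -natrX ltr_nat ltn_expl.
have := metric_triangle c c' x; rewrite (metric_sym c c').
set u := 2 ^+ m * r; set v := tau * r in r't *; rewrite -mulrA -/v; lra.
Qed.

Lemma sigma_finite_ball : sigma_finite [set: M] mu.
Proof.
have /set0P[c _] : [set: M] != set0.
  by apply: contraTneq mu_gt0 => ->; rewrite measure0 ltxx.
exists (fun n => ball c n%:R).
  by rewrite -[LHS](bigcup_setI_ball c); apply: eq_bigcupr => n _; rewrite setTI.
by move=> n; split => //; exact: measurable_borel_ball.
Qed.

End doubling.

(** * Means over sets of positive finite mass *)

Section averages.
Context {d : measure_display} {R : realType} {M : borelMetricType d R}.
Variable mu : {measure set M -> \bar R}.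
Implicit Types (A : set M) (g f : M -> R) (c : R).

Lemma meanE A g : (0 < mu A)%E -> (mu A < +oo)%E ->
  mean mu A g = ((fine (mu A))^-1%:E * \int[mu]_(x in A) (g x)%:E)%E.
Proof.
move=> A0 Aoo; rewrite /mean -[X in (X^-1)%E]fineK ?ge0_fin_numE// inver.
by rewrite gt_eqF// fine_gt0// A0 Aoo.
Qed.

Lemma lt_mean A g c : (0 < mu A)%E -> (mu A < +oo)%E ->
  (c%:E < mean mu A g)%E = (c%:E * mu A < \int[mu]_(x in A) (g x)%:E)%E.
Proof.
move=> A0 Aoo; rewrite meanE// lte_pdivlMl ?fine_gt0 ?A0//.
by rewrite fineK ?ge0_fin_numE// muleC.
Qed.

Lemma le_mean A g c : (0 < mu A)%E -> (mu A < +oo)%E ->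
  (mean mu A g <= c%:E)%E = (\int[mu]_(x in A) (g x)%:E <= c%:E * mu A)%E.
Proof. by move=> A0 Aoo; rewrite leNgt lt_mean// -leNgt. Qed.

Lemma local_sharp_ball b f p m (o : M) (r : R) : (local_sharp mu b f p <= m)%E ->
  0 < r <= b -> ball o r p ->
  (mean mu (ball o r) (fun x => `|f x - fine (mean mu (ball o r) f)|)%R <= m)%E.
Proof.
by move=> fm rb cp; apply: le_trans fm; apply: ereal_sup_ubound; exists o, r.
Qed.

Lemma ge0_integral_le_cstD A g1 g2 c : measurable A ->
  measurable_fun A g2 -> 0 <= c -> measurable_fun A g1 ->
  (forall x, A x -> 0 <= g1 x) -> (forall x, A x -> 0 <= g2 x) ->
  (forall x, A x -> g1 x <= c + g2 x) ->
  (\int[mu]_(x in A) (g1 x)%:E <= c%:E * mu A + \int[mu]_(x in A) (g2 x)%:E)%E.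
Proof.
move=> mA m2 c0 m1 g10 g20 g12.
rewrite -(integral_cst mu mA) -ge0_integralD//; last exact/measurable_EFinP.
apply: ge0_le_integral => //.
- exact/measurable_EFinP.
- by apply/measurable_EFinP; apply: measurable_funD.
Qed.

End averages.

(** * Dyadic cubes, their maximal members and the weak type inequality *)

Section dyadic.
Context {d : measure_display} {R : realType} {M : borelMetricType d R}.
Variable mu : {measure set M -> \bar R}.
Hypothesis mu_gt0 : (0 < mu [set: M])%E.
Hypothesis mu_ball_fin : forall (c : M) (r : R), (mu (ball c r) < +oo)%E.
Hypothesis LDP : locally_doubling mu.
Variables (I : int -> Type) (Q : forall k : int, I k -> set M).
Variables (z : forall k : int, I k -> M) (delta a0 C1 : R).
Hypotheses (delta_itv : 0 < delta < 1) (a0_gt0 : 0 < a0) (C1_gt0 : 0 < C1).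
Hypothesis cubes : dyadic_cubes mu Q z delta a0 C1.
Implicit Types (F : forall k : int, I k -> Prop).

Lemma delta_exp_gt0 (k : int) : 0 < delta ^ k.
Proof. by rewrite exprz_gt0//; case/andP: delta_itv. Qed.

Lemma cube_dist k (a : I k) x y : Q a x -> Q a y -> mdist x y <= C1 * delta ^ k.
Proof.
move=> ax ay; rewrite -lee_fin; apply: le_trans (cube_diam cubes a).
by apply: ereal_sup_ubound; exists (x, y).
Qed.

Lemma measurable_cube k (a : I k) : measurable (Q a).
Proof. exact/borel_open/(cube_open cubes). Qed.

Lemma cube_center k (a : I k) : Q a (z a).
Proof.
by apply: (cube_ball cubes); apply/ballP; rewrite mdistxx mulr_gt0// delta_exp_gt0.
Qed.

Lemma mu_cube_gt0 k (a : I k) : (0 < mu (Q a))%E.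
Proof.
apply: lt_le_trans (_ : mu (ball (z a) (a0 * delta ^ k)) <= _)%E.
  by apply: mu_ball_gt0 => //; rewrite mulr_gt0// delta_exp_gt0.
apply: le_measure; rewrite ?inE; last exact: (cube_ball cubes).
  exact: measurable_borel_ball.
exact: measurable_cube.
Qed.

Lemma mu_cube_fin k (a : I k) : (mu (Q a) < +oo)%E.
Proof.
apply: le_lt_trans (_ : _ <= mu (ball (z a) (C1 * delta ^ k + 1)))%E _ => //.
apply: le_measure; rewrite ?inE.
- exact: measurable_cube.
- exact: measurable_borel_ball.
move=> x ax; apply/ballP; rewrite (le_lt_trans (cube_dist (cube_center a) ax))//.
by rewrite ltrDl.
Qed.

(** One set may be a cube at several resolutions; comparing with all strictly coarser cubes makes
    its coarsest index in [F] the only candidate. *)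
Definition maximal_cube F k (a : I k) :=
  F k a /\ forall l (g : I l), l < k -> F l g -> ~ Q a `<=` Q g.

Definition cube_union F := [set x | exists k, exists2 a : I k, F k a & Q a x].

(** The lower bound on resolutions gives a coarsest cube of [F] through [x]; a coarser cube of [F]
    containing it would contain [x] too. *)
Lemma exists_maximal_cube F (k0 : int) x : (forall k (a : I k), F k a -> k0 <= k) ->
  cube_union F x -> exists k, exists2 a : I k, maximal_cube F a & Q a x.
Proof.
move=> Fk0 [k [a Fa ax]].
pose P n := `[< exists2 g : I (k0 + n%:Z), F _ g & Q g x >].
have exP : exists n, P n.
  exists (absz (k - k0)); apply/asboolP.
  suff -> : k0 + `|k - k0|%N%:Z = k by exists a.
  have := Fk0 _ _ Fa; lia.
case: (ex_minnP exP) => n /asboolP[g Fg gx] nmin.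
exists (k0 + n%:Z), g => //; split=> // l h ln Fh gh.
have kl := Fk0 _ _ Fh.
have : P (absz (l - k0)).
  apply/asboolP; have -> : k0 + `|l - k0|%N%:Z = l by lia.
  by exists h => //; exact: gh.
by move/nmin; lia.
Qed.

Lemma sub_maximal_cube F k (a : I k) l (g : I l) x : maximal_cube F a -> F l g ->
  Q a x -> Q g x -> Q g `<=` Q a.
Proof.
move=> [Fa amax] Fg ax gx; have [kl|lk] := leP k l.
  have [//|E] := cube_nested cubes a g kl.
  by have : set0 x by rewrite -E.
have [|E] := cube_nested cubes g a (ltW lk); first by move/(amax _ _ lk Fg).
by have : set0 x by rewrite -E.
Qed.

(** The index types [I k] are arbitrary; countability comes from maximal cubes being disjoint and of
    positive mass in a sigma-finite space. *)
Lemma maximal_cube_seq F (k0 : int) : (forall k (a : I k), F k a -> k0 <= k) ->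
  exists G : nat -> set M, [/\ trivIset setT G, \bigcup_n G n = cube_union F &
    forall n, G n = set0 \/ exists k, exists2 a : I k, maximal_cube F a & G n = Q a].
Proof.
move=> Fk0.
pose FF : set (set M) := [set A | exists k, exists2 a : I k, maximal_cube F a & A = Q a].
have tFF : trivIset FF id.
  move=> _ _ [k [a Fa ->]] [l [g Fg ->]] [x [ax gx]].
  apply/seteqP; split; first exact: (sub_maximal_cube Fg (proj1 Fa) gx ax).
  exact: (sub_maximal_cube Fa (proj1 Fg) ax gx).
have cFF : countable FF.
  apply: (@countable_disjoint_family _ _ _ mu) => //; first exact: sigma_finite_ball.
    by move=> _ [k [a _ ->]]; exact: measurable_cube.
  by move=> _ [k [a _ ->]]; exact: mu_cube_gt0.
have [G [tG UG GF]] := countable_disjoint_seq cFF tFF.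
exists G; split => //; rewrite UG; apply/seteqP; split=> x.
  by move=> [_ [k [a [Fa _] ->]] ax]; exists k, a.
by move=> /(exists_maximal_cube Fk0)[k [a Fa ax]]; exists (Q a) => //; exists k, a.
Qed.

Lemma measurable_cube_union F : measurable (cube_union F).
Proof.
have -> : cube_union F = \bigcup_k \bigcup_(a in [set a : I k | F k a]) Q a.
  apply/seteqP; split=> x; first by move=> [k [a Fa ax]]; exists k => //; exists a.
  by move=> [k _ [a Fa ax]]; exists k, a.
apply: borel_open; apply: bigcup_open => k _; apply: bigcup_open => a _.
exact: (cube_open cubes).
Qed.

(** No covering constant is lost: the maximal cubes of [F] are disjoint and have the same union, so
    the hypothesis is summed over them. *)
Lemma weak_type_cubes F (k0 : int) (E : set M) (g : M -> \bar R) (c : R) :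
  (forall k (a : I k), F k a -> k0 <= k) ->
  measurable E -> (forall k (a : I k), F k a -> Q a `<=` E) ->
  measurable_fun E g -> (forall x, E x -> 0 <= g x)%E -> 0 <= c ->
  (forall k (a : I k), F k a -> c%:E * mu (Q a) <= \int[mu]_(x in Q a) g x)%E ->
  (c%:E * mu (cube_union F) <= \int[mu]_(x in E) g x)%E.
Proof.
move=> Fk0 mE FE mg g0 c0 cg.
have [G [tG UG GF]] := maximal_cube_seq Fk0.
have mG n : measurable (G n).
  by case: (GF n) => [->|[k [a _ ->]]] //; exact: measurable_cube.
have UE : cube_union F `<=` E by move=> x [k [a /FE]]; exact.
apply: (@le_trans _ _ (\int[mu]_(x in \bigcup_n G n) g x)%E); last first.
  by rewrite UG; apply: ge0_subset_integral => //; exact: measurable_cube_union.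
rewrite ge0_integral_bigcup//; last 2 first.
- by rewrite UG; apply: measurable_funS mg.
- by rewrite UG => x /UE; exact: g0.
rewrite -UG measure_bigcup// -nneseriesZl//.
rewrite [leLHS](_ : _ = \sum_(i <oo) c%:E * mu (G i))%E; last first.
  by apply: eq_eseriesl => i; rewrite in_setT.
apply: lee_nneseries => n _; first by rewrite mule_ge0.
have [->|[k [a [Fa _] ->]]] := GF n; last exact: cg.
by rewrite measure0 mule0 integral_set0.
Qed.

(** * Heavy cubes, the sharp function and the boundary layer *)

Variables (f : M -> R).
Hypothesis mf : measurable_fun [set: M] f.

Definition heavy_cube (c : R) (k : int) (a : I k) :=
  2 <= k /\ (c%:E < mean mu (Q a) (fun x => `|f x|)%R)%E.

Lemma dyadic_maximal_gtE (c : R) :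
  [set x | (c%:E < dyadic_maximal mu Q 2 f x)%E] = cube_union (heavy_cube c).
Proof.
apply/seteqP; split=> x /=.
  by move=> /ereal_sup_gt[_ [l [a [l2 ax ->]]] cx]; exists l, a.
move=> [l [a [l2 ca] ax]]; apply: lt_le_trans ca _.
by apply: ereal_sup_ubound; exists l, a.
Qed.

Variable b' : R.
Hypothesis b'_gt0 : 0 < b'.
Let D := doubling_const mu (b' / a0) a0.
Hypothesis D_gt0 : 0 < D.

Lemma delta_exp_le (k l : int) : 0 <= l <= k -> delta ^ k <= delta ^ l.
Proof.
case/andP: delta_itv => d0 d1 /andP[l0 lk].
by apply: ler_wpiXz2l => //; rewrite ?ltW// -?topredE/= ?(le_trans l0).
Qed.

Lemma delta_exp_le1 (k : int) : 0 <= k -> delta ^ k <= 1.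
Proof. by move=> k0; rewrite -(expr0z delta) delta_exp_le// lexx. Qed.

(** This explains the parameters of [D]: the ball inside the cube has radius [a0 * delta ^ l <= a0],
    and the ratio of radii is at most [b' / a0] because [delta ^ k <= delta ^ l]. *)
Lemma ball_cube_doubling (k l : int) (o : M) (p : I l) :
  0 <= l <= k -> Q p `<=` ball o (b' * delta ^ k) ->
  (mu (ball o (b' * delta ^ k)) <= D%:E * mu (Q p))%E.
Proof.
move=> /andP[l0 lk] pB.
have dl := delta_exp_gt0 l; have dk := delta_exp_gt0 k.
have pp : ball (z p) (a0 * delta ^ l) `<=` Q p by exact: (cube_ball cubes).
apply: (@le_trans _ _ (D%:E * mu (ball (z p) (a0 * delta ^ l)))%E).
  apply: doubling_constP => //.
  - by rewrite mulr_gt0//= ger_pMr// delta_exp_le1.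
  - by rewrite mulr_gt0//= mulrA divfK ?gt_eqF// ler_pM2l// delta_exp_le// l0.
  - exact: subset_trans pp pB.
rewrite lee_wpmul2l//; first by rewrite lee_fin ltW.
apply: le_measure; rewrite ?inE//; first exact: measurable_borel_ball.
exact: measurable_cube.
Qed.

(** Both superlevel sets are open, being unions of cubes and of balls. *)
Lemma measurable_relative_level (c e : R) :
  measurable [set x | (c%:E < dyadic_maximal mu Q 2 f x)%E /\
    (local_sharp mu b' f x <= e%:E)%E].
Proof.
rewrite (_ : [set x | _] = [set x | (c%:E < dyadic_maximal mu Q 2 f x)%E] `\`
    [set x | (e%:E < local_sharp mu b' f x)%E]); last first.
  by apply/seteqP; split=> x /= [cx] sx; split => //; move: sx; rewrite leNgt => /negP.
apply: measurableD.
  by rewrite dyadic_maximal_gtE; exact: measurable_cube_union.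
apply: borel_open; rewrite openE => x /= /ereal_sup_gt[m [w [r [rb /ballP wx ->]]] em].
apply/nbhs_ballP; exists (r - mdist w x) => /=; first by rewrite subr_gt0.
move=> y /ballP xy; apply: lt_le_trans em _; apply: ereal_sup_ubound.
exists w, r; split=> //; apply/ballP.
by have := metric_triangle w x y; lra.
Qed.

Variables (eta' eps alpha : R).
Hypotheses (eta'_itv : 0 < eta' < 1) (eps_itv : 0 < eps < (1 - eta') / (2 * D)).
Hypothesis alpha_gt0 : 0 < alpha.

(** The light cube [p] controls the mean of [f] on the ball, so a mean of [|f|] above [alpha] on a
    subcube of [Q a] forces a large oscillation there. *)
Lemma good_cube (k l : int) (a : I k) (p : I l) :
  maximal_cube (heavy_cube (eta' * alpha)) a -> 2 <= l <= k ->
  ~ heavy_cube (eta' * alpha) p ->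
  Q a `<=` ball (z a) (b' * delta ^ k) -> Q p `<=` ball (z a) (b' * delta ^ k) ->
  (mu ([set x | (alpha%:E < dyadic_maximal mu Q 2 f x)%E /\
               (local_sharp mu b' f x <= (eps * alpha)%:E)%E] `&` Q a)
    <= (2 * eps * D / (1 - eta'))%:E * mu (Q a))%E.
Proof.
move=> amax /andP[l2 lk] pheavy aB pB.
have l0 : 0 <= l := le_trans (isT : (0 : int) <= 2) l2.
have k0 := le_trans l0 lk.
case/andP: eta'_itv => eta'0 eta'1; case/andP: eps_itv => eps0 epsD.
set c := 2 * eps * D / (1 - eta').
have c0 : 0 <= c by rewrite divr_ge0 ?mulr_ge0 ?subr_ge0// ltW.
have mua0 := mu_cube_gt0 a.
have muaoo := mu_cube_fin a.
have mup0 := mu_cube_gt0 p.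
have mupoo := mu_cube_fin p.
set S := [set x | _ /\ _].
(* If the set is nonempty, one point [y] of it suffices to bound the oscillation over the whole
   ball. *)
have [->|/set0P[y [[ay fy] Qy]]] := eqVneq (S `&` Q a) set0.
  by rewrite measure0 mule_ge0.
set B := ball _ _ in aB pB.
have mB : measurable B by exact: measurable_borel_ball.
have rB : 0 < b' * delta ^ k <= b'.
  by rewrite mulr_gt0 ?delta_exp_gt0//= ger_pMr// delta_exp_le1.
have muB0 : (0 < mu B)%E by apply: mu_ball_gt0 => //; case/andP: rB.
have muBoo : (mu B < +oo)%E by exact: mu_ball_fin.
have := local_sharp_ball fy rB (aB _ Qy).
rewrite -/B; set fB := fine _; rewrite le_mean//.
set h := fun x => `|f x - fB| => hB.
have mh A : measurable_fun A h.
  apply: measurableT_comp => //; apply: measurable_funB => //.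
  exact: measurable_funS mf.
have mabsf A : measurable_fun A (fun x => `|f x|).
  by apply: measurableT_comp => //; exact: measurable_funS mf.
(* Doubling replaces [mu B] by the mass of a cube inside [B], at the cost of a factor [D]. *)
have sub_B q (b : I q) : Q b `<=` B -> 0 <= q <= k ->
    (\int[mu]_(x in Q b) (h x)%:E <= (eps * alpha * D)%:E * mu (Q b))%E.
  move=> bB qk; apply: (@le_trans _ _ (\int[mu]_(x in B) (h x)%:E)%E).
    apply: ge0_subset_integral => //; first exact: measurable_cube.
      exact/measurable_EFinP.
    by move=> x _; rewrite lee_fin normr_ge0.
  apply: (le_trans hB); rewrite (EFinM _ D) -muleA lee_wpmul2l//.
    by rewrite lee_fin mulr_ge0// ltW.
  exact: ball_cube_doubling.
(* The pointwise bound of [|fB|] by [|f| + h] is averaged over the light cube. *)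
have fB_le : `|fB| <= (eta' + eps * D) * alpha.
  have /negP : ~ ((eta' * alpha)%:E < mean mu (Q p) (fun x => `|f x|)%R)%E.
    by move=> hp; apply: pheavy.
  rewrite -leNgt le_mean// => fp.
  have hp : (\int[mu]_(x in Q p) (h x)%:E <= (eps * alpha * D)%:E * mu (Q p))%E.
    by apply: sub_B => //; rewrite l0 lk.
  have : (\int[mu]_(x in Q p) (`|fB|)%:E <= (0%R)%:E * mu (Q p) +
       \int[mu]_(x in Q p) (`|f x| + h x)%:E)%E.
    apply: ge0_integral_le_cstD => //.
    - exact: measurable_cube.
    - exact: measurable_funD (mabsf _) (mh _).
    - by move=> x _; apply: addr_ge0; exact: normr_ge0.
    - by move=> x _; rewrite add0r /h; have := ler_normB (f x) (f x - fB); rewrite subKr.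
  rewrite mul0e add0e integral_cst; last exact: measurable_cube.
  under [leRHS]eq_integral do rewrite EFinD.
  rewrite ge0_integralD//; last 4 first.
  - exact: measurable_cube.
  - exact/measurable_EFinP.
  - by move=> x _; rewrite lee_fin normr_ge0.
  - exact/measurable_EFinP.
  move=> /le_trans/(_ (leeD fp hp)).
  rewrite -[mu (Q p)]fineK ?ge0_fin_numE// -!EFinM -EFinD lee_fin -mulrDl.
  by rewrite ler_pM2r ?fine_gt0 ?mup0//; lra.
(* The bound on [eps] ensures that where [|f|] has mean above [alpha], [h] has mean at least [alpha
   - (eta' + eps * D) * alpha >= alpha * (1 - eta') / 2]. *)
have epsD' : eps * D < (1 - eta') / 2.
  by move: epsD; rewrite invfM mulrA ltr_pdivlMr.
pose F q (b : I q) := heavy_cube alpha b /\ Q b `<=` Q a.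
have weak : ((alpha * (1 - eta') / 2)%:E * mu (cube_union F)
    <= \int[mu]_(x in Q a) (h x)%:E)%E.
  apply: (weak_type_cubes (k0 := 2)).
  - by move=> q b [[]].
  - exact: measurable_cube.
  - by move=> q b [].
  - exact/measurable_EFinP.
  - by move=> x _; rewrite lee_fin normr_ge0.
  - by rewrite divr_ge0 ?mulr_ge0 ?subr_ge0// ltW.
  move=> q b [[q2 fb] ba].
  have mub0 := mu_cube_gt0 b.
  have muboo := mu_cube_fin b.
  have mubfin : mu (Q b) \is a fin_num by rewrite ge0_fin_numE.
  have mb := measurable_cube b.
  have fbh : (\int[mu]_(x in Q b) (`|f x|)%:E <= (`|fB|)%:E * mu (Q b) +
       \int[mu]_(x in Q b) (h x)%:E)%E.
    apply: ge0_integral_le_cstD => // x _; first exact: normr_ge0.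
    by rewrite /h; have := ler_normD fB (f x - fB); rewrite subrKC.
  move: fb; rewrite lt_mean// => /ltW/le_trans/(_ fbh).
  rewrite -leeBlDl; last by rewrite fin_numM.
  rewrite -muleBl// -EFinB; apply: le_trans.
  rewrite lee_wpmul2r// lee_fin.
  have := ler_pM2r alpha_gt0 (eps * D) ((1 - eta') / 2); rewrite (ltW epsD').
  by move: fB_le; rewrite mulrDl; lra.
(* A cube heavy at level [alpha] is heavy at level [eta' * alpha], so if it meets the maximal [Q a]
   it lies inside it. *)
have SF : S `&` Q a `<=` cube_union F.
  move=> x [[ax _] Qx].
  have [q [b hb bx]] : cube_union (heavy_cube alpha) x.
    by rewrite -dyadic_maximal_gtE.
  exists q, b => //; split=> //; apply: (sub_maximal_cube amax _ Qx bx).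
  case: hb => q2 hb; split=> //; apply: le_lt_trans hb.
  by rewrite lee_fin ger_pMl// ltW.
have mS : measurable (S `&` Q a).
  apply: measurableI; last exact: measurable_cube.
  exact: measurable_relative_level.
have lam0 : 0 < alpha * (1 - eta') / 2 by rewrite divr_gt0 ?mulr_gt0 ?subr_gt0.
have : ((alpha * (1 - eta') / 2)%:E * mu (S `&` Q a) <= (eps * alpha * D)%:E * mu (Q a))%E.
  apply: (@le_trans _ _ ((alpha * (1 - eta') / 2)%:E * mu (cube_union F))%E).
    rewrite lee_wpmul2l//; first by rewrite lee_fin ltW.
    by apply: le_measure; rewrite ?inE//; exact: measurable_cube_union.
  by apply: (le_trans weak); apply: sub_B; rewrite // k0 lexx.
rewrite -lee_pdivlMl// => /le_trans; apply.
rewrite muleA -EFinM lee_wpmul2r// lee_fin.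
have -> : (alpha * (1 - eta') / 2)^-1 * (eps * alpha * D) = c.
  by rewrite /c; field; rewrite !gt_eqF ?subr_gt0.
by [].
Qed.


Hypotheses (b'_ge1 : 2 * C1 + C1 / delta <= b') (b'_ge2 : 2 * C1 + delta <= b').

Let A := cube_union (heavy_cube (eta' * alpha)).
(* The points covered by no cube of resolution 2 are outside [A], since the maximal
   function is [-oo] there; they are added back, so that the boundary of [A'] is
   approached by points of light cubes. *)
Let A' := (A `|` ~` \bigcup_(a : I 2) Q a)°.

(** The two lower bounds on [b'] serve the two cases: the term [C1 / delta] covers the diameter of
    the parent cube, the term [delta] the gap crossed at resolution 2. *)
Lemma light_cube_near_boundary (s : R) (k : int) (a : I k) :
  s < delta ^ 3 -> maximal_cube (heavy_cube (eta' * alpha)) a ->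
  Q a `&` inner_boundary A' s !=set0 ->
  exists l, exists p : I l, [/\ 2 <= l <= k, ~ heavy_cube (eta' * alpha) p,
    Q a `<=` ball (z a) (b' * delta ^ k) & Q p `<=` ball (z a) (b' * delta ^ k)].
Proof.
move=> s_lt amax [x [ax [_ /set_dist_leP xA']]].
have [delta0 delta1] := andP delta_itv.
have dk := delta_exp_gt0 k.
have k2 : 2 <= k by case: amax => -[].
have C1d : 0 < C1 / delta by rewrite divr_gt0.
have b'1 : 2 * C1 < b' by rewrite (lt_le_trans _ b'_ge1)// ltrDl.
have b'2 : C1 / delta < b' by rewrite (lt_le_trans _ b'_ge1)// ltrDr mulr_gt0.
have aB : Q a `<=` ball (z a) (b' * delta ^ k).
  move=> y ay; apply/ballP; apply: le_lt_trans (cube_dist (cube_center a) ay) _.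
  by rewrite ltr_pM2r//; lra.
move: k2; rewrite le_eqVlt => /orP[/eqP k2|k2].
  subst k.
  have [|y nA'y xy] := xA' (delta ^ 3 - s); first by rewrite subr_gt0.
  rewrite subrKC in xy.
  (* As [y] is not interior, arbitrarily near it is a [w] outside [A] that a cube of resolution 2
     covers; the strict bound on [mdist x y] leaves room to choose it. *)
  have [w yw nw] : exists2 w, mdist y w < delta ^ 3 - mdist x y &
      ~ (A `|` ~` \bigcup_(a : I 2) Q a) w.
    apply: contrapT => nw; apply: nA'y; rewrite /A' /interior /=.
    apply/nbhs_ballP; exists (delta ^ 3 - mdist x y) => /=; first by rewrite subr_gt0.
    by move=> w /ballP yw; apply: contrapT => nAw; apply: nw; exists w.
  have [p _ pw] : (\bigcup_(a : I 2) Q a) w.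
    by apply: contrapT => nQw; apply: nw; right.
  exists 2, p; split=> //.
    by move=> hp; apply: nw; left; exists 2, p.
  move=> v pv; apply/ballP.
  (* From the centre to [v] there are two cube diameters and a gap below [delta ^ 3], in total less
     than [(2 * C1 + delta) * delta ^ 2]. *)
  have d3 : delta ^ 3 = delta * delta ^ 2 :> R by rewrite -exprS.
  have : (2 * C1 + delta) * delta ^ 2 <= b' * delta ^ 2 by rewrite ler_pM2r.
  have := cube_dist (cube_center a) ax; have := cube_dist pw pv.
  have := metric_triangle (z a) x v; have := metric_triangle x y v.
  have := metric_triangle y w v.
  rewrite d3 in yw; move: yw; set u := delta ^ 2; lra.
have k1k : k - 1 < k by rewrite ltrBlDr ltrDl.
(* The parent is light by maximality of [a], and its diameter is at most
   [C1 / delta * delta ^ k]. *)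
have [p [ap _]] := cube_ancestor cubes a k1k.
exists (k - 1), p; split=> //.
- by rewrite (ltW k1k) andbT; clear -k2; lia.
- by move=> hp; case: amax => _ /(_ _ _ k1k hp).
move=> v pv; apply/ballP.
apply: le_lt_trans (cube_dist (ap _ (cube_center a)) pv) _.
have -> : delta ^ (k - 1) = delta ^ k / delta.
  by rewrite expfzDr ?gt_eqF// exprN1.
by rewrite mulrCA mulrC ltr_pM2r.
Qed.

(** Maximal cubes missing the boundary layer are charged in full to what erosion leaves of [A]; in
    the others only the fraction from [good_cube] counts. Summing gives the two terms of the
    factor. *)
Lemma relative_inequality (s tau : R) : s < delta ^ 3 -> 0 <= tau ->
  (forall B : set M, open B -> (mu B < +oo)%E ->
    (mu (B `\` inner_boundary B s) <= tau%:E * mu B)%E) ->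
  (mu A < +oo)%E ->
  (mu [set x | (alpha%:E < dyadic_maximal mu Q 2 f x)%E /\
               (local_sharp mu b' f x <= (eps * alpha)%:E)%E]
    <= (tau + 2 * eps * D / (1 - eta'))%:E * mu A)%E.
Proof.
move=> s_lt tau0 erosion Aoo.
have eta'1 : eta' < 1 by case/andP: eta'_itv.
have eps0 : 0 < eps by case/andP: eps_itv.
set c := 2 * eps * D / (1 - eta').
have c0 : 0 <= c by rewrite divr_ge0 ?mulr_ge0 ?subr_ge0// ltW.
set S := [set x | _ /\ _].
have mS : measurable S by exact: measurable_relative_level.
have mA : measurable A by exact: measurable_cube_union.
have oA' : open A' by exact: open_interior.
have mA' := borel_open oA'.
have mQ2 : measurable (\bigcup_(a : I 2) Q a).
  by apply/borel_open/bigcup_open => a _; exact: (cube_open cubes).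
have AA' : A `<=` A'.
  move=> x Ax; rewrite /A' /interior /=; apply: (@filterS _ _ _ A); first by left.
  have [k [a ha ax]] := Ax.
  have := cube_open cubes a; rewrite openE => /(_ x ax).
  by apply: filterS => y ay; exists k, a.
(* The added points form a null set, so the erosion of [A'] can be measured against [mu A]. *)
have muA' : mu A' = mu A.
  apply/eqP; rewrite eq_le; apply/andP; split; last by rewrite le_measure ?inE.
  apply: (@le_trans _ _ (mu (A `|` ~` \bigcup_(a : I 2) Q a))).
    apply: le_measure; rewrite ?inE//; last exact: interior_subset.
    by apply: measurableU => //; exact: measurableC.
  apply: le_trans (measureU2 mu mA (measurableC mQ2)) _.
  by rewrite [X in (_ + X <= _)%E](_ : _ = 0%E) ?adde0//; exact: (cube_full cubes 2).
have {erosion} HA' := erosion _ oA'; rewrite muA' in HA'; move/(_ Aoo): HA' => HA'.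
set bd := inner_boundary A' s in HA' *.
have mbd : measurable bd by exact: measurable_inner_boundary.
have [G [tG UG GF]] := @maximal_cube_seq (heavy_cube (eta' * alpha)) 2 (fun k a h => proj1 h).
have mG n : measurable (G n).
  by case: (GF n) => [->|[k [a _ ->]]] //; exact: measurable_cube.
have SA : S `<=` A.
  move=> x [ax _]; rewrite /A -dyadic_maximal_gtE /=; apply: le_lt_trans ax.
  by rewrite lee_fin ger_pMl// ltW.
have SG n : (mu (S `&` G n) <= mu (G n `\` bd) + c%:E * mu (G n))%E.
  have [->|[k [a amax ->]]] := GF n.
    by rewrite setI0 set0D !measure0 mule0 adde0.
  have ma := measurable_cube a.
  have [abd|abd] := pselect (Q a `&` bd !=set0).
    have [l [p [lk pheavy aB pB]]] := light_cube_near_boundary s_lt amax abd.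
    apply: le_trans (good_cube amax lk pheavy aB pB) _.
    by rewrite leeDr.
  rewrite setDidl; last first.
    by apply: contrapT => /eqP/set0P.
  apply: (@le_trans _ _ (mu (Q a))).
    apply: le_measure; rewrite ?inE//; exact: measurableI.
  by rewrite leeDl// mule_ge0.
have -> : S = \bigcup_n (S `&` G n) by rewrite -setI_bigcupr UG setIidl.
rewrite measure_bigcup//; last 2 first.
- by move=> n _; exact: measurableI.
- exact: trivIset_setIl.
apply: (@le_trans _ _ (\sum_(n <oo) (mu (G n `\` bd) + c%:E * mu (G n)))%E).
  rewrite [leLHS](_ : _ = \sum_(n <oo) mu (S `&` G n))%E; last first.
    by apply: eq_eseriesl => i; rewrite in_setT.
  exact: lee_nneseries.
rewrite nneseriesD//; last by move=> n _ _; rewrite mule_ge0.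
rewrite nneseriesZl//.
have GE : (\sum_(n <oo) mu (G n) = mu A)%E.
  rewrite /A -UG measure_bigcup//.
  by apply: eq_eseriesl => i; rewrite in_setT.
have GbdE : (\sum_(n <oo) mu (G n `\` bd) = mu (A `\` bd))%E.
  rewrite /A -UG setDE setI_bigcupl measure_bigcup//; last 2 first.
  - by move=> n _; apply: measurableD.
  - exact: trivIset_setIr.
  by apply: eq_eseriesl => i; rewrite in_setT.
rewrite GE GbdE EFinD muleDl//; last by rewrite ge0_fin_numE.
rewrite leeD2r// (le_trans _ HA')// le_measure ?inE//; try exact: measurableD.
exact: setSD.
Qed.

(** By the weak type inequality on all of [M], the mass is at most the L1 norm of [f] over
    [eta' * alpha]. Finiteness makes the decay under erosion applicable to a possibly unbounded
    set. *)
Lemma heavy_cube_union_fin : mu.-integrable [set: M] (EFin \o f) -> (mu A < +oo)%E.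
Proof.
move=> /integrableP[_ foo]; have [eta'0 _] := andP eta'_itv.
have : ((eta' * alpha)%:E * mu A <= \int[mu]_x (`|f x|)%:E)%E.
  apply: (weak_type_cubes (k0 := 2)) => //.
  - by move=> k a [].
  - by apply/measurable_EFinP; exact: measurableT_comp.
  - by rewrite mulr_ge0// ltW.
  move=> k a [_ ]; rewrite lt_mean ?mu_cube_gt0 ?mu_cube_fin//; exact: ltW.
rewrite -lee_pdivlMl ?mulr_gt0// => /le_lt_trans; apply.
by rewrite lte_mul_pinfty// lee_fin invr_ge0 mulr_ge0// ltW.
Qed.

End dyadic.

(** * Choice of the layer width and assembly of the constants *)

Theorem lemma7p2 (d : measure_display) (R : realType) (M : borelMetricType d R)
    (mu : {measure set M -> \bar R})
    (M_unbounded : ~ metric_bounded [set: M])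
    (mu_gt0 : (0 < mu [set: M])%E)
    (mu_ball_fin : forall (c : M) (r : R), (mu (ball c r) < +oo)%E)
    (LDP : locally_doubling mu)
    (kappa0 : R) (kappa0_gt0 : 0 < kappa0)
    (isoperimetric : exists2 C : R, 0 < C & isoperimetric_ineq mu kappa0 C)
    (R0 beta : R) (R0_ge0 : 0 <= R0) (beta_itv : 1 / 2 < beta < 1)
    (AMP : approximate_midpoint (M := M) R0 beta)
    (b0 : R) (b0_gt : R0 / (1 - beta) < b0)
    (I : int -> Type) (Q : forall k : int, I k -> set M)
    (z : forall k : int, I k -> M)
    (delta a0 C1 : R) (delta_itv : 0 < delta < 1)
    (a0_gt0 : 0 < a0) (C1_gt0 : 0 < C1)
    (cubes : dyadic_cubes mu Q z delta a0 C1) :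
  let C0 := Num.max (C1 / delta) delta in
  let b' := Num.max b0 (2 * C1 + C0) in
  let sigma :=
    (1 - fine (expeR (- (isoperimetric_limit mu kappa0 * (delta ^+ 3)%:E)))) / 2 in
  let D := doubling_const mu (b' / a0) a0 in
  forall (eta' : R), 0 < eta' < 1 ->
  forall (eps : R), 0 < eps < (1 - eta') / (2 * D) ->
  forall f : M -> R, mu.-integrable [set: M] (EFin \o f) ->
  let eta := 1 - sigma + 2 * eps * D / (sigma * (1 - eta')) in
  forall alpha : R, 0 < alpha ->
  (mu [set x | (alpha%:E < dyadic_maximal mu Q 2 f x)%E
             /\ (local_sharp mu b' f x <= (eps * alpha)%:E)%E]
   <= eta%:E * mu [set x | ((eta' * alpha)%:E < dyadic_maximal mu Q 2 f x)%E])%E.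
Proof.
move=> C0 b' sigma D eta' eta'_itv eps eps_itv f intf eta alpha alpha0.
have [delta0 delta1] := andP delta_itv.
have [eta'0 eta'1] := andP eta'_itv; have [eps0 epsD] := andP eps_itv.
have C0b' : 2 * C1 + C0 <= b' by rewrite le_max lexx orbT.
have b'_ge1 : 2 * C1 + C1 / delta <= b'.
  by apply: le_trans C0b'; rewrite lerD2l le_max lexx.
have b'_ge2 : 2 * C1 + delta <= b'.
  by apply: le_trans C0b'; rewrite lerD2l le_max lexx orbT.
have b'0 : 0 < b' by lra.
(* For [D <= 0] the bound on [eps] would be at most 0, division by zero giving 0, so no [eps] would
   be admissible. *)
have D0 : 0 < D.
  have := lt_trans eps0 epsD.
  by rewrite pmulr_rgt0 ?subr_gt0// invr_gt0 pmulr_rgt0.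
have [C C00 isoC] := isoperimetric.
have [/andP[q0 q1] [t [C' [t0 C'0 isoC' decay]]]] :=
  isoperimetric_limit_decay kappa0_gt0 C00 isoC (exprn_gt0 3 delta0).
have sigma0 : 0 < sigma by rewrite divr_gt0// subr_gt0.
have sigma1 : sigma <= 1 by rewrite /sigma; lra.
have mf : measurable_fun [set: M] f by move/integrableP : intf => [/measurable_EFinP].
have Aoo : (mu (cube_union Q (heavy_cube mu Q f (eta' * alpha))) < +oo)%E.
  exact: (heavy_cube_union_fin mu_gt0 mu_ball_fin LDP delta_itv a0_gt0 C1_gt0 cubes).
have s_lt : 3 / 4 * delta ^+ 3 < delta ^ 3.
  by have := exprn_gt0 3 delta0; rewrite -exprnP; lra.
have tau0 : 0 <= 1 - sigma by rewrite subr_ge0.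
have erosion B : open B -> (mu B < +oo)%E ->
    (mu (B `\` inner_boundary B (3 / 4 * delta ^+ 3)) <= (1 - sigma)%:E * mu B)%E.
  move=> oB Boo.
  have s0 : 0 < 3 / 4 * delta ^+ 3 by rewrite mulr_gt0 ?exprn_gt0.
  apply: le_trans (isoperimetric_exp t0 C'0 isoC' s0 oB Boo) _.
  (* With [q] the exponential in [sigma], the bound [(1 + q) / 2] is exactly [1 - sigma]. *)
  rewrite lee_wpmul2r// lee_fin (le_trans decay)//; rewrite /sigma; lra.
have main := relative_inequality mu_gt0 mu_ball_fin LDP delta_itv a0_gt0 C1_gt0 cubes
  mf b'0 D0 eta'_itv eps_itv alpha0 b'_ge1 b'_ge2 s_lt tau0 erosion Aoo.
rewrite dyadic_maximal_gtE; apply: (le_trans main).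
(* The second term of [eta] is the one in [main] divided by [sigma], and [sigma <= 1]. *)
rewrite lee_wpmul2r// lee_fin lerD2l (invfM sigma) mulrCA ler_peMl//.
  by rewrite divr_ge0 ?mulr_ge0 ?subr_ge0// ltW.
by rewrite invf_ge1.
Qed.
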